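(* Let $G_1,G_2,\dots,G_k$ be finite simple graphs with pairwise disjoint vertex sets $V_i=V(G_i)$ and edge sets $E_i=E(G_i)$, $1\le i\le k$, none of which has a well-connected vertex. Then \[ C^\xi(G_1+G_2+\cdots+G_k) = \sum_{i=1}^k |E(G_i)| + \frac12\Big(\sum_{i=1}^k |V(G_i)|\Big)^2 - \frac12\sum_{i=1}^k |V(G_i)|^2 . \]
   Context: A vertex of a graph is well-connected if it is adjacent to all other vertices of the graph. The join $G_1+\cdots+G_k$ of graphs with pairwise disjoint vertex sets has vertex set $V_1\cup\cdots\cup V_k$ and edge set $E_1\cup\cdots\cup E_k$ together with all edges $xy$ with $x\in V_i$, $y\in V_j$, $i\neq j$. For a connected graph $H$, $d_H(v)$ is the degree of $v$, the eccentricity $\varepsilon_H(v)$ is the largest distance from $v$ to any other vertex, and the connective eccentric index is $C^\xi(H)=\sum_{v\in V(H)} \frac{d_H(v)}{\varepsilon_H(v)}$.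
   Formalization: The formal theorem assumes k ≥ 2 and that every G_i has at least one vertex; for k = 1 the formula fails (the path on 4 vertices has index 8/3, while the formula gives 3), and adding an empty graph as a second part gives the same failure. *)

(* Defs.v *)
From HB Require Import structures.
From mathcomp Require Import all_boot all_order all_algebra.
Set Implicit Arguments.
Unset Strict Implicit.
Unset Printing Implicit Defensive.
Import Order.TTheory GRing.Theory Num.Theory.

Record sgraph := SGraph {
  vertex :> finType;
  adj : rel vertex;
  adj_sym : symmetric adj;
  adj_irrefl : irreflexive adj
}.

Section Graph.
Variable G : sgraph.
Implicit Types (u v x y : G) (n : nat).

Definition edges : {set {set G}} :=
  [set [set e.1; e.2] | e in [set e : G * G | adj e.1 e.2]].

Definition well_connected v : bool := [forall u, (u != v) ==> adj v u].

Definition connected : bool := [forall x, forall y, connect (@adj G) x y].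

Definition degree v : nat := #|[set u | adj v u]|.

Definition walk x y n : bool :=
  [exists p : n.-tuple G, path (@adj G) x p && (last x p == y)].

(* The least length of a walk from x to y: such a walk, if there is one, has
   fewer than #|G| edges. The value for an unreachable y is the dummy #|G|. *)
Definition dist x y : nat := find (walk x y) (iota 0 #|G|).

Definition eccentricity v : nat := \max_(u | u != v) dist v u.

(* Meaningful for connected graphs only. *)
Definition connective_eccentric_index : rat :=
  (\sum_(v : G) (degree v)%:R / (eccentricity v)%:R)%R.

Lemma walkP x y n :
  reflect (exists p : seq G, [/\ size p = n, path (@adj G) x p & last x p = y])
          (walk x y n).
Proof.
apply: (iffP existsP) => [[p /andP[pP /eqP lP]]|[p [sp pP lP]]].
  by exists p; rewrite size_tuple.
have /eqP sp' := sp.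
by exists (Tuple sp'); rewrite /= pP lP eqxx.
Qed.

Lemma dist_walk x y : connect (@adj G) x y -> walk x y (dist x y).
Proof.
case/connectP=> p0 /shortenP[p pP uP _] lP.
have sP : size p < #|G|.
  by have := max_card (mem (x :: p)); rewrite (card_uniqP uP).
have hW : has (walk x y) (iota 0 #|G|).
  apply/hasP; exists (size p); first by rewrite mem_iota.
  by apply/walkP; exists p; rewrite -lP.
have lt_f : dist x y < #|G| by move: hW; rewrite has_find size_iota.
by have := nth_find 0 hW; rewrite nth_iota.
Qed.

Lemma dist_le x y n : walk x y n -> dist x y <= n.
Proof.
move=> W; rewrite leqNgt; apply/negP => lt_n.
have lt_nG : n < #|G|.
  by apply: leq_trans lt_n _; rewrite -[leqRHS](size_iota 0) find_size.
by have := before_find 0 lt_n; rewrite nth_iota // add0n W.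
Qed.

End Graph.

Section Join.
Variables (k : nat) (G : 'I_k -> sgraph).

(* The dependent pairs (i, v) with v a vertex of G i form the disjoint union of
   the vertex sets; tagged_as x y is y seen as a vertex of G (tag x). *)
Definition join_adj : rel {i : 'I_k & G i} :=
  fun x y => (tag x != tag y) || adj (tagged x) (tagged_as x y).

Lemma join_adj_sym : symmetric join_adj.
Proof.
move=> [i x] [j y]; rewrite /join_adj /=; have [eq_ij|ne_ij] := eqVneq i j.
  by subst j; rewrite !tagged_asE adj_sym.
by [].
Qed.

Lemma join_adj_irrefl : irreflexive join_adj.
Proof. by case=> i x; rewrite /join_adj /= eqxx tagged_asE adj_irrefl. Qed.

Definition join : sgraph := SGraph join_adj_sym join_adj_irrefl.

Lemma join_connected :
  1 < k -> (forall i, 0 < #|G i|) -> connected join.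
Proof.
move=> k_gt1 G_gt0; apply/forallP=> x; apply/forallP=> y.
have [eq_t|ne_t] := eqVneq (tag x) (tag y); last first.
  by apply: connect1; rewrite /= /join_adj ne_t.
have [j ne_j] : exists j, j != tag x.
  apply/existsP; apply: contraLR k_gt1 => /existsPn all_x; rewrite -leqNgt.
  rewrite -[k]card_ord -(card1 (tag x)); apply: subset_leq_card.
  by apply/subsetP => j _; rewrite inE; have := all_x j; rewrite negbK.
have /card_gt0P[z _] := G_gt0 j.
apply: (@connect_trans _ _ (Tagged (fun i => vertex (G i)) z : join));
  apply: connect1; rewrite /= /join_adj /=.
  by rewrite eq_sym ne_j.
by rewrite -eq_t ne_j.
Qed.

End Join.

(* Main.v *)
Require Import Defs.
From HB Require Import structures.
From mathcomp Require Import all_boot all_order all_algebra.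
From mathcomp Require Import ring.
Set Implicit Arguments.
Unset Strict Implicit.
Unset Printing Implicit Defensive.
Import Order.TTheory GRing.Theory Num.Theory.

(** Without well-connected vertices, every vertex of the join has eccentricity
    exactly 2: a vertex it misses in its own part is reached through any other
    part. Hence the index is half the degree sum. A vertex of [G i] is joined to
    everything outside [G i], so the degree sum is
    [2 * \sum_i #|E i| + \sum_i n_i * (N - n_i)] with [n_i = #|V i|] and
    [N = \sum_i n_i]. *)

Lemma eq_set2 (T : finType) (a b c d : T) :
  ([set a; b] == [set c; d]) = ((a, b) == (c, d)) || ((a, b) == (d, c)).
Proof.
rewrite !xpair_eqE; apply/eqP/idP => [eq_ab|/orP[]/andP[/eqP-> /eqP->] //].
  (* The rewrites exchange the two sets, so that each of the four elements lies in the opposite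
     pair; a Boolean check remains. *)
  have := set21 a b; have := set22 a b; have := set21 c d; have := set22 c d.
  rewrite eq_ab -{1 2}eq_ab !inE (eq_sym d) (eq_sym d) (eq_sym c) (eq_sym c).
  by case: (a == c); case: (a == d); case: (b == c); case: (b == d).
by rewrite setUC.
Qed.

(** Handshake: both sides count ordered adjacent pairs, grouped by first component or by underlying
    edge. *)
Lemma sum_degree (H : sgraph) : \sum_(v : H) degree v = 2 * #|edges H|.
Proof.
have -> : \sum_(v : H) degree v = #|[set e : H * H | adj e.1 e.2]|.
  under eq_bigr do rewrite /degree -sum1_card.
  rewrite pair_big_dep -sum1_card.
  by apply: eq_bigl => e; rewrite !inE.
rewrite -sum1_card.
rewrite (partition_big_imset (fun e : H * H => [set e.1; e.2])) /=.
rewrite mulnC -sum_nat_const; apply: eq_bigr => _ /imsetP[[a b] ab ->] /=.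
move: ab; rewrite inE /= => ab.
have ne_ab : a != b by apply: contraTneq ab => ->; rewrite adj_irrefl.
(* The fibre over an edge consists of its two orderings, distinct by irreflexivity. *)
rewrite sum1dep_card -[RHS](_ : #|[set (a, b); (b, a)]| = 2); last first.
  by rewrite cards2 xpair_eqE negb_and ne_ab.
apply: eq_card => -[c d]; rewrite !inE eq_set2 /=.
case: eqP => [[-> ->]|_]; first by rewrite ab.
by case: eqP => [[-> ->]|_]; rewrite ?andbF //= adj_sym ab.
Qed.

Section Join.
Variables (k : nat) (G : 'I_k -> sgraph).

Lemma sum_join (F : join G -> nat) :
  \sum_x F x = \sum_i \sum_(v : G i) F (Tagged (fun i => vertex (G i)) v).
Proof. by rewrite sig_big_dep /=; apply: eq_bigr => -[]. Qed.

(** The additive form avoids truncated subtraction in [nat]. *)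
Lemma degree_join (x : join G) :
  degree x + #|G (tag x)| = degree (tagged x) + \sum_i #|G i|.
Proof.
have -> : degree x = \sum_(y : join G) adj x y.
  rewrite /degree -sum1dep_card big_mkcond.
  by apply: eq_bigr => y _; case: (adj x y).
rewrite sum_join.
(* The part of [x] is split off on both sides: there adjacency is that of the part, elsewhere it is
   always true. *)
rewrite (bigD1 (tag x)) //= [in RHS](bigD1 (tag x)) //=.
rewrite addnAC -!addnA [in RHS]addnCA addnCA; congr (_ + (_ + _)).
  rewrite /degree -sum1dep_card [RHS]big_mkcond /=; apply: eq_bigr => v _.
  rewrite /join_adj eqxx /=; case: x v => i u v.
  by rewrite tagged_asE; case: ifP.
apply: eq_bigr => i ne_i; rewrite -sum1_card; apply: eq_bigr => v _.
by rewrite /join_adj /= eq_sym ne_i.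
Qed.

Lemma sum_degree_join :
  \sum_(x : join G) degree x + \sum_i #|G i| ^ 2
  = 2 * \sum_i #|edges (G i)| + (\sum_i #|G i|) ^ 2.
Proof.
(* Each square is spread over the vertices of its part, so that [degree_join] applies termwise. *)
have -> : \sum_i #|G i| ^ 2 = \sum_(x : join G) #|G (tag x)|.
  by rewrite sum_join; apply: eq_bigr => i _ /=; rewrite sum_nat_const mulnn.
rewrite -big_split /=; under eq_bigr do rewrite degree_join.
rewrite sum_join /= big_distrr -mulnn [in RHS]big_distrl -big_split /=.
by apply: eq_bigr => i _; rewrite big_split /= sum_degree sum_nat_const.
Qed.

Hypotheses (k_gt1 : 1 < k) (G_gt0 : forall i, 0 < #|G i|).

Lemma dist_join_le2 (x y : join G) : dist x y <= 2.
Proof.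
have [xy|] := boolP (adj x y).
  apply: (@leq_trans 1) => //; apply/dist_le/walkP; exists [:: y].
  by split=> //=; rewrite andbT.
rewrite /= /join_adj negb_or negbK => /andP[/eqP eq_t _].
have [j ne_j] : exists j, j != tag x.
  apply/existsP; rewrite -[[exists _, _]]/(~~ pred0b (predC1 (tag x))).
  by rewrite -lt0n cardC1 card_ord; case: k k_gt1 => [|[]].
have /card_gt0P[z _] := G_gt0 j.
(* The walk through [z] also covers [x = y], as walks may revisit vertices. *)
apply/dist_le/walkP; exists [:: (Tagged (fun i => G i) z : join G); y].
by rewrite /= /join_adj /= -eq_t ne_j eq_sym ne_j.
Qed.

Lemma dist_join_nonadj (x y : join G) : x != y -> ~~ adj x y -> dist x y = 2.
Proof.
move=> ne_xy nxy; apply/eqP; rewrite eqn_leq dist_join_le2 /=.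
(* Connectedness makes [dist x y] the length of an actual walk. Length 0 would force [x = y], length
   1 adjacency. *)
have /forallP/(_ x)/forallP/(_ y)/dist_walk := join_connected k_gt1 G_gt0.
case: (dist x y) => [|[|//]] /walkP[[|z [|? ?]] []] //= _.
  by move=> _ eq_xy; rewrite eq_xy eqxx in ne_xy.
by rewrite andbT => xz eq_zy; rewrite -eq_zy /= xz in nxy.
Qed.

Lemma eccentricity_join (x : join G) :
  ~~ well_connected (tagged x) -> eccentricity x = 2.
Proof.
case: x => i v /= /forallPn[u]; rewrite negb_imply => /andP[ne_uv nvu].
pose T (w : G i) : join G := Tagged (fun i => vertex (G i)) w.
apply/eqP; rewrite eqn_leq; apply/andP; split.
  by apply/bigmax_leqP => y _; apply: dist_join_le2.
have ne : T u != T v by rewrite /T -tag_eqE /tag_eq /= eqxx tagged_asE.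
(* A non-neighbour [u] of [v] in its own part remains one in the join, so it attains the bound 2. *)
rewrite -(@dist_join_nonadj (T v) (T u)); last 2 first.
- by rewrite eq_sym.
- by rewrite /= /join_adj /= eqxx tagged_asE.
exact: (@leq_bigmax_cond _ _ (dist (T v))).
Qed.

End Join.

Theorem theorem4 (k : nat) (G : 'I_k -> sgraph)
    (k_ge2 : 2 <= k)
    (G_nonempty : forall i : 'I_k, 0 < #|G i|)
    (G_nowc : forall i : 'I_k, ~ exists v : G i, well_connected v) :
  (connective_eccentric_index (join G)
   = \sum_(i < k) #|edges (G i)|%:R
     + 2%:R^-1 * (\sum_(i < k) #|G i|%:R) ^+ 2
     - 2%:R^-1 * \sum_(i < k) #|G i|%:R ^+ 2)%R.
Proof.
rewrite /connective_eccentric_index.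
have ecc (x : join G) : eccentricity x = 2.
  apply: eccentricity_join => //; apply/negP => wc.
  by apply: (G_nowc (tag x)); exists (tagged x).
under eq_bigr do rewrite ecc.
rewrite -mulr_suml -!natr_sum.
have -> : (\sum_(i < k) #|G i|%:R ^+ 2 = (\sum_(i < k) #|G i| ^ 2)%:R :> rat)%R.
  by rewrite natr_sum; apply: eq_bigr => i _; rewrite natrX.
(* Cast to [rat], the identity can be solved for the degree sum. *)
have /(congr1 (fun n => n%:R : rat)%R) := sum_degree_join G.
rewrite 2!natrD natrX natrM => /(canRL (addrK _)) ->.
by field.
Qed.
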